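(* Let $A\in\mathbf{R}^{n\times n}$ be symmetric positive definite, $b\in\mathbf{R}^n$, $x_0\in\mathbf{R}^n$, and let $(x_k)$ be the iterates of the conjugate gradient (CG) algorithm for minimizing $f(x)=\tfrac12x^TAx-x^Tb$ started at $x_0$. For $k\ge1$ put $s_k=x_k-x_{k-1}$ and $W_k=[\,g_k,\ s_k\,]\in\mathbf{R}^{n\times2}$. Then, for every $k\ge1$ with $g_k\neq0$, the CG iterate satisfies $$x_{k+1}=x_k-W_ka_k,\qquad a_k=\begin{bmatrix}\alpha_k^{(1)}\\ \alpha_k^{(2)}\end{bmatrix}=\begin{bmatrix}g_k^TAg_k&g_k^TAs_k\\ s_k^TAg_k&s_k^TAs_k\end{bmatrix}^{-1}\begin{bmatrix}g_k^Tg_k\\ s_k^Tg_k\end{bmatrix},$$ that is, CG coincides with the Flexible Scheme with $\ell=0$, $\omega=1$, no preconditioning and search directions $W_k=[\,g_k,\ s_k\,]$. More precisely, $$\alpha_k^{(1)}=\alpha_k^{CG},\qquad \alpha_k^{(2)}=-\alpha_k^{CG}\,\frac{s_k^TAg_k}{s_k^TAs_k}.$$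
   Context: Notation: $g_k=\nabla f(x_k)=Ax_k-b$. The CG algorithm: with $d_{-1}=0\in\mathbf{R}^n$ and $\beta_{-1}^{CG}=0$, for all $k\ge0$ (as long as $g_k\ne0$), $$x_{k+1}=x_k+\alpha_k^{CG}d_k,\qquad d_k=-g_k+\beta_{k-1}^{CG}d_{k-1},$$ $$\alpha_k^{CG}=-\frac{d_k^Tg_k}{d_k^TAd_k},\qquad \beta_{k-1}^{CG}=\frac{d_{k-1}^TAg_k}{d_{k-1}^TAd_{k-1}}\quad(k\ge1).$$ The Flexible Scheme (without preconditioning, relaxation parameter $\omega=1$, norm parameter $\ell=0$) is the iteration $x_{k+1}=x_k-W_ka_k$ with $a_k=(W_k^TAW_k)^{-1}W_k^Tg_k$, where $W_k\in\mathbf{R}^{n\times m_k}$ has linearly independent columns and $g_k\in\mathrm{col}(W_k)$. *)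

(* Defs.v *)
From mathcomp Require Import all_boot all_order all_algebra.
From mathcomp Require Import ring.

Set Implicit Arguments.
Unset Strict Implicit.
Unset Printing Implicit Defensive.

Import Order.TTheory GRing.Theory Num.Theory.
Local Open Scope ring_scope.

(* The Euclidean inner product u^T v as a scalar. *)
Definition dotv (R : realFieldType) (n : nat) (u v : 'cV[R]_n) : R :=
  (u^T *m v) 0 0.

Definition spd (R : realFieldType) (n : nat) (A : 'M[R]_n) : Prop :=
  A^T = A /\ (forall v : 'cV[R]_n, v != 0 -> 0 < dotv v (A *m v)).

Definition quad_obj (R : realFieldType) (n : nat) (A : 'M[R]_n)
    (b x : 'cV[R]_n) : R :=
  2%:R^-1 * dotv x (A *m x) - dotv x b.

(* The gradient of [quad_obj A b] when A is symmetric, see [quad_obj_expand]. *)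
Definition quad_grad (R : realFieldType) (n : nat) (A : 'M[R]_n)
    (b x : 'cV[R]_n) : 'cV[R]_n :=
  A *m x - b.

Definition cg_step_length (R : realFieldType) (n : nat) (A : 'M[R]_n)
    (g d : 'cV[R]_n) : R :=
  - dotv d g / dotv d (A *m d).

Definition cg_conj_coef (R : realFieldType) (n : nat) (A : 'M[R]_n)
    (dprev g : 'cV[R]_n) : R :=
  dotv dprev (A *m g) / dotv dprev (A *m dprev).

(* The pair (x_k, d_k). Since d_{-1} = 0 and beta_{-1} = 0, d_0 = - g_0.
   The recursion is total: by 0^-1 = 0, once some g_k = 0 it stays at x_k
   forever, see [cg_stop]; so g_k != 0 says that CG has not stopped at or
   before step k. *)
Fixpoint cg_state (R : realFieldType) (n : nat) (A : 'M[R]_n)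
    (b x0 : 'cV[R]_n) (k : nat) : 'cV[R]_n * 'cV[R]_n :=
  match k with
  | 0 => (x0, - quad_grad A b x0)
  | k'.+1 =>
      let x := (cg_state A b x0 k').1 in
      let d := (cg_state A b x0 k').2 in
      let x' := x + cg_step_length A (quad_grad A b x) d *: d in
      let g' := quad_grad A b x' in
      (x', - g' + cg_conj_coef A d g' *: d)
  end.

Definition cg_x (R : realFieldType) (n : nat) (A : 'M[R]_n)
    (b x0 : 'cV[R]_n) (k : nat) : 'cV[R]_n := (cg_state A b x0 k).1.

Definition cg_d (R : realFieldType) (n : nat) (A : 'M[R]_n)
    (b x0 : 'cV[R]_n) (k : nat) : 'cV[R]_n := (cg_state A b x0 k).2.

Definition cg_g (R : realFieldType) (n : nat) (A : 'M[R]_n)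
    (b x0 : 'cV[R]_n) (k : nat) : 'cV[R]_n := quad_grad A b (cg_x A b x0 k).

Definition cg_alpha (R : realFieldType) (n : nat) (A : 'M[R]_n)
    (b x0 : 'cV[R]_n) (k : nat) : R :=
  cg_step_length A (cg_g A b x0 k) (cg_d A b x0 k).

(* The first two conjuncts are the admissibility of the search directions:
   the columns of W are linearly independent, and the gradient lies in their
   span (both phrased on W^T, row spaces being the library's convention). *)
Definition flexible_step (R : realFieldType) (n m : nat) (A : 'M[R]_n)
    (b x : 'cV[R]_n) (W : 'M[R]_(n, m)) (x' : 'cV[R]_n) : Prop :=
  let g := quad_grad A b x in
  [/\ row_free W^T,
      (g^T <= W^T)%MS &
      x' = x - W *m (invmx (W^T *m A *m W) *m (W^T *m g))].

Lemma dotvDl (R : realFieldType) n (u v w : 'cV[R]_n) :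
  dotv (u + v) w = dotv u w + dotv v w.
Proof. by rewrite /dotv linearD mulmxDl mxE. Qed.

Lemma dotvDr (R : realFieldType) n (u v w : 'cV[R]_n) :
  dotv u (v + w) = dotv u v + dotv u w.
Proof. by rewrite /dotv mulmxDr mxE. Qed.

Lemma dotvNr (R : realFieldType) n (u v : 'cV[R]_n) :
  dotv u (- v) = - dotv u v.
Proof. by rewrite /dotv mulmxN mxE. Qed.

Lemma dotvC (R : realFieldType) n (u v : 'cV[R]_n) : dotv u v = dotv v u.
Proof. by rewrite /dotv -[in LHS](trmxK v) -trmx_mul mxE. Qed.

Lemma dotv_sym (R : realFieldType) n (A : 'M[R]_n) (u v : 'cV[R]_n) :
  A^T = A -> dotv u (A *m v) = dotv v (A *m u).
Proof. by move=> hA; rewrite dotvC /dotv trmx_mul hA mulmxA. Qed.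

Lemma quad_obj_expand (R : realFieldType) n (A : 'M[R]_n) (b x h : 'cV[R]_n) :
  A^T = A ->
  quad_obj A b (x + h) =
    quad_obj A b x + dotv (quad_grad A b x) h + 2%:R^-1 * dotv h (A *m h).
Proof.
move=> hA; rewrite /quad_obj /quad_grad mulmxDr !dotvDl !dotvDr.
rewrite (dotv_sym x h hA) [dotv (A *m x) h]dotvC.
rewrite [dotv (- b) h]dotvC dotvNr; by field.
Qed.

Lemma cg_xS (R : realFieldType) n (A : 'M[R]_n) (b x0 : 'cV[R]_n) k :
  cg_x A b x0 k.+1 = cg_x A b x0 k + cg_alpha A b x0 k *: cg_d A b x0 k.
Proof. by []. Qed.

Lemma cg_dS (R : realFieldType) n (A : 'M[R]_n) (b x0 : 'cV[R]_n) k :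
  cg_d A b x0 k.+1 =
    - cg_g A b x0 k.+1
    + cg_conj_coef A (cg_d A b x0 k) (cg_g A b x0 k.+1) *: cg_d A b x0 k.
Proof. by []. Qed.

Lemma cg_stop (R : realFieldType) n (A : 'M[R]_n) (b x0 : 'cV[R]_n) k j :
  cg_g A b x0 k = 0 -> (k <= j)%N -> cg_x A b x0 j = cg_x A b x0 k.
Proof.
move=> gk0; have d0 i : cg_g A b x0 i = 0 -> cg_d A b x0 i = 0.
  case: i => [|i] gi0; first by rewrite /cg_d /= (gi0 : quad_grad A b x0 = 0) oppr0.
  rewrite cg_dS gi0 /cg_conj_coef mulmx0 /dotv mulmx0 mxE mul0r scale0r.
  by rewrite oppr0 addr0.
elim: j => [|j IHj]; first by rewrite leqn0 => /eqP ->.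
rewrite leq_eqVlt => /orP[/eqP -> //|]; rewrite ltnS => /IHj xj.
by rewrite cg_xS d0 ?scaler0 ?addr0 // /cg_g xj.
Qed.

(* Main.v *)
Require Import Defs.
From mathcomp Require Import all_boot all_order all_algebra.
Import Order.TTheory GRing.Theory Num.Theory.
Local Open Scope ring_scope.

(** A flexible step minimizes the objective over the affine plane
    [x + col W]: it is the only step [x - W a] whose new gradient is orthogonal
    to the columns of [W] ([galerkin_coef]).  So it is enough to see that the CG
    iterate [x_{k+1}] lies in [x_k + span(g_k, s_k)] and that [g_{k+1}] is
    orthogonal to [g_k] and [s_k].

    Since [s_k = alpha_{k-1} d_{k-1}] and [d_k = - g_k + beta d_{k-1}], the pairs
    [(g_k, s_k)] and [(d_k, d_{k-1})] span the same plane, and CG moves inside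
    it.  Exact line search gives [d_k^T g_{k+1} = 0] ([cg_d_ortho_next]), and
    [A]-conjugacy of consecutive directions carries the earlier relation
    [d_{k-1}^T g_k = 0] over to [d_{k-1}^T g_{k+1} = 0]
    ([cg_d_ortho_next2]).  The coefficients are read off the change of basis.

    The plane is two-dimensional: [g_k] and [s_k] are orthogonal, and [s_k] is
    nonzero because CG has not stopped earlier and
    [d_{k-1}^T g_{k-1} = - |g_{k-1}|^2] ([cg_descent]) makes the step length
    [alpha_{k-1}] and the direction [d_{k-1}] nonzero. *)

(** * Inner products and positive definite forms *)

Lemma dotvZr (R : realFieldType) n (c : R) (u v : 'cV[R]_n) :
  dotv u (c *: v) = c * dotv u v.
Proof. by rewrite /dotv -scalemxAr mxE. Qed.

Lemma dotvZl (R : realFieldType) n (c : R) (u v : 'cV[R]_n) :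
  dotv (c *: u) v = c * dotv u v.
Proof. by rewrite dotvC dotvZr dotvC. Qed.

Lemma dotv0l (R : realFieldType) n (v : 'cV[R]_n) : dotv 0 v = 0.
Proof. by rewrite /dotv trmx0 mul0mx mxE. Qed.

Lemma dotvv_eq0 (R : realFieldType) n (v : 'cV[R]_n) :
  (dotv v v == 0) = (v == 0).
Proof.
apply/eqP/eqP => [|->]; last exact: dotv0l.
rewrite /dotv mxE => /eqP; rewrite psumr_eq0 => [/allP h|i _]; last first.
  by rewrite mxE -expr2 sqr_ge0.
apply/colP => i; rewrite mxE; apply/eqP.
by have := h i (mem_index_enum i); rewrite mxE -expr2 sqrf_eq0.
Qed.

Lemma tr_mul_dotv (R : realFieldType) n (u v : 'cV[R]_n) :
  u^T *m v = (dotv u v)%:M.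
Proof. by rewrite [LHS]mx11_scalar. Qed.

Lemma spd_dotv_eq0 (R : realFieldType) n (A : 'M[R]_n) (v : 'cV[R]_n) :
  spd A -> (dotv v (A *m v) == 0) = (v == 0).
Proof.
case=> _ posA; case: (eqVneq v 0) => [->|v0]; first by rewrite dotv0l eqxx.
by rewrite gt_eqF ?posA.
Qed.

(** A row vector [u] in the left kernel gives [W u^T] with zero [A]-energy, hence
    [W u^T = 0] and [u = 0] by independence of the columns. *)
Lemma gram_unitmx (R : realFieldType) n m (A : 'M[R]_n) (W : 'M[R]_(n, m)) :
  spd A -> row_free W^T -> W^T *m A *m W \in unitmx.
Proof.
move=> hA freeW; rewrite -row_free_unit; apply: inj_row_free => u uG.
apply: (row_free_inj freeW); rewrite mul0mx; apply: trmx_inj.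
rewrite trmx0 trmx_mul trmxK; apply/eqP; rewrite -(spd_dotv_eq0 _ _ _ _ hA).
by rewrite /dotv trmx_mul trmxK !mulmxA -(mulmxA u) -(mulmxA u) uG mul0mx mxE.
Qed.

Lemma row_free_ortho_pair (R : realFieldType) n (u v : 'cV[R]_n) :
  u != 0 -> v != 0 -> dotv u v = 0 -> row_free (row_mx u v)^T.
Proof.
move=> u0 v0 uv; apply: inj_row_free => w; rewrite tr_row_mx -[w]hsubmxK.
rewrite mul_row_col => w0.
have l0 : lsubmx w = 0.
  have := congr1 (mulmxr u) w0; rewrite /= mulmxDl -!mulmxA !tr_mul_dotv.
  rewrite [dotv v u]dotvC uv !mul_mx_scalar scale0r addr0 mul0mx => /eqP.
  by rewrite scaler_eq0 dotvv_eq0 (negPf u0) => /eqP.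
have r0 : rsubmx w = 0.
  have := congr1 (mulmxr v) w0; rewrite /= mulmxDl -!mulmxA !tr_mul_dotv.
  rewrite uv !mul_mx_scalar scale0r add0r mul0mx => /eqP.
  by rewrite scaler_eq0 dotvv_eq0 (negPf v0) => /eqP.
by rewrite l0 r0 row_mx0.
Qed.

(** * The flexible step as a Galerkin condition *)

Lemma quad_gradD (R : realFieldType) n (A : 'M[R]_n) (b x h : 'cV[R]_n) :
  quad_grad A b (x + h) = quad_grad A b x + A *m h.
Proof. by rewrite /quad_grad mulmxDr addrAC. Qed.

(** Orthogonality of the new gradient to the columns of [W] is the normal
    equation [(W^T A W) a = W^T g], whose matrix is invertible. *)
Lemma galerkin_coef (R : realFieldType) n m (A : 'M[R]_n) (b x : 'cV[R]_n)
    (W : 'M[R]_(n, m)) (a : 'cV[R]_m) :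
  spd A -> row_free W^T -> W^T *m quad_grad A b (x - W *m a) = 0 ->
  invmx (W^T *m A *m W) *m (W^T *m quad_grad A b x) = a.
Proof.
move=> hA freeW; rewrite quad_gradD mulmxN mulmxBr => /eqP.
rewrite subr_eq0 => /eqP ->; rewrite (mulmxA A) (mulmxA W^T) (mulmxA W^T A).
by rewrite mulKmx ?gram_unitmx.
Qed.

(** * Orthogonality relations of conjugate gradients *)

Lemma cg_conj_coefZ (R : realFieldType) n (A : 'M[R]_n) (c : R)
    (u v : 'cV[R]_n) :
  c != 0 -> cg_conj_coef A (c *: u) v = c^-1 * cg_conj_coef A u v.
Proof.
move=> c0; rewrite /cg_conj_coef -scalemxAr !dotvZl dotvZr -mulf_div divff //.
by rewrite mul1r invfM mulrCA.
Qed.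

Section ConjugateGradients.

Variables (R : realFieldType) (n : nat) (A : 'M[R]_n) (b x0 : 'cV[R]_n).
Hypothesis hA : spd A.

Local Notation x := (cg_x A b x0).
Local Notation g := (cg_g A b x0).
Local Notation d := (cg_d A b x0).
Local Notation alpha := (cg_alpha A b x0).
Local Notation beta k := (cg_conj_coef A (d k) (g k.+1)).

Lemma cg_gS k : g k.+1 = g k + alpha k *: (A *m d k).
Proof. by rewrite /cg_g cg_xS quad_gradD -scalemxAr. Qed.

(** The step length is the exact minimizer along [d k]. *)
Lemma cg_d_ortho_next k : dotv (d k) (g k.+1) = 0.
Proof.
have [d0|d0] := eqVneq (d k) 0; first by rewrite d0 dotv0l.
rewrite cg_gS dotvDr dotvZr /cg_alpha /cg_step_length divfK ?subrr //.
by rewrite spd_dotv_eq0.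
Qed.

Lemma cg_d_conj_next k : dotv (d k) (A *m d k.+1) = 0.
Proof.
have [d0|d0] := eqVneq (d k) 0; first by rewrite d0 dotv0l.
rewrite cg_dS mulmxDr mulmxN -scalemxAr dotvDr dotvNr dotvZr /cg_conj_coef.
by rewrite divfK ?addNr // spd_dotv_eq0.
Qed.

(** By conjugacy, moving along [d k.+1] does not change the slope in the
    direction [d k], which the previous line search made zero. *)
Lemma cg_d_ortho_next2 k : dotv (d k) (g k.+2) = 0.
Proof.
by rewrite cg_gS dotvDr dotvZr cg_d_conj_next mulr0 addr0 cg_d_ortho_next.
Qed.

Lemma cg_g_ortho_next k : dotv (g k.+1) (g k.+2) = 0.
Proof.
have -> : g k.+1 = beta k *: d k + (-1) *: d k.+1.
  by rewrite scaleN1r cg_dS opprD opprK addrCA subrr addr0.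
by rewrite dotvDl !dotvZl cg_d_ortho_next2 cg_d_ortho_next !mulr0 addr0.
Qed.

(** The multiple of the previous direction in [d k] contributes nothing, by the
    previous line search.  With this the step cannot degenerate before CG
    stops. *)
Lemma cg_descent k : dotv (d k) (g k) = - dotv (g k) (g k).
Proof.
case: k => [|k]; first by rewrite dotvC dotvNr.
rewrite dotvC cg_dS dotvDr dotvNr dotvZr [dotv _ (d k)]dotvC.
by rewrite cg_d_ortho_next mulr0 addr0.
Qed.

Lemma cg_d_neq0 k : g k != 0 -> d k != 0.
Proof.
apply: contraNneq => d0; rewrite -dotvv_eq0 -oppr_eq0 -cg_descent d0.
by rewrite dotv0l.
Qed.

Lemma cg_alpha_neq0 k : g k != 0 -> alpha k != 0.
Proof.
move=> g0; rewrite mulf_eq0 negb_or invr_eq0 spd_dotv_eq0 ?cg_d_neq0 //.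
by rewrite cg_descent opprK dotvv_eq0 g0.
Qed.

Lemma cg_running k j : (k <= j)%N -> g j != 0 -> g k != 0.
Proof.
move=> le_kj; apply: contraNneq => gk0.
by rewrite /cg_g (cg_stop gk0 le_kj) -/(g k) gk0.
Qed.

Lemma cg_diff k : x k.+1 - x k = alpha k *: d k.
Proof. by rewrite cg_xS addrC addKr. Qed.

End ConjugateGradients.

(** * Conjugate gradients as a flexible scheme *)

Theorem mainTheorem6 (R : realFieldType) (n : nat) (A : 'M[R]_n)
    (b x0 : 'cV[R]_n) (hA : spd A) (k : nat) (hk : (1 <= k)%N)
    (hg : cg_g A b x0 k != 0) :
  let x := cg_x A b x0 in
  let g := cg_g A b x0 k in
  let s := x k - x k.-1 in
  let W : 'M[R]_(n, 1 + 1) := row_mx g s in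
  let G : 'M[R]_(1 + 1) :=
    block_mx (g^T *m A *m g) (g^T *m A *m s)
             (s^T *m A *m g) (s^T *m A *m s) in
  let a : 'cV[R]_(1 + 1) :=
    invmx G *m col_mx (g^T *m g) (s^T *m g) in
  [/\ G \in unitmx,
      x k.+1 = x k - W *m a,
      flexible_step A b (x k) W (x k.+1),
      a ord0 ord0 = cg_alpha A b x0 k &
      a ord_max ord0
        = - cg_alpha A b x0 k * (dotv s (A *m g) / dotv s (A *m s))].
Proof.
case: k hk hg => [//|k] _ gS0 x g s W G a.
have g0 : cg_g A b x0 k != 0 by apply: cg_running gS0; exact: leqnSn.
have al0 := cg_alpha_neq0 _ _ _ b x0 hA _ g0.
have d0 := cg_d_neq0 _ _ _ b x0 hA _ g0.
have sE : s = cg_alpha A b x0 k *: cg_d A b x0 k by exact: cg_diff.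
have s0 : s != 0 by rewrite sE scaler_eq0 negb_or al0.
have gs : dotv g s = 0.
  by rewrite sE dotvZr dotvC cg_d_ortho_next ?mulr0.
have freeW : row_free W^T by exact: row_free_ortho_pair.
have GE : G = W^T *m A *m W by rewrite /W tr_row_mx mul_col_mx mul_col_row.
have Wg : col_mx (g^T *m g) (s^T *m g) = W^T *m g.
  by rewrite /W tr_row_mx mul_col_mx.
set al := cg_alpha A b x0 k.+1; set q := dotv s (A *m g) / dotv s (A *m s).
pose a' : 'cV[R]_(1 + 1) := col_mx al%:M (- al * q)%:M.
(* Rescaling d_k to s_k divides the coefficient and multiplies the vector. *)
have qs : q *: s = cg_conj_coef A (cg_d A b x0 k) g *: cg_d A b x0 k.
  rewrite /q -/(cg_conj_coef A s g) sE cg_conj_coefZ // scalerA.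
  by rewrite mulrAC mulVf // mul1r.
have xE : x k.+2 = x k.+1 - W *m a'.
  rewrite /x cg_xS cg_dS -/g -qs -/al /W /a' mul_row_col !mul_mx_scalar.
  by rewrite scalerDr scalerN scalerA mulNr scaleNr opprD opprK.
have aE : a = a'.
  rewrite /a GE Wg; apply: galerkin_coef => //.
  rewrite -xE -/(cg_g A b x0 k.+2) /W tr_row_mx mul_col_mx !tr_mul_dotv.
  rewrite cg_g_ortho_next // sE dotvZl cg_d_ortho_next2 // mulr0.
  by rewrite -scalemx1 scale0r col_mx0.
split.
- by rewrite GE gram_unitmx.
- by rewrite aE.
- split=> //; last by rewrite xE -aE /a GE Wg.
  by rewrite /W tr_row_mx -addsmxE addsmxSl.
- have -> : ord0 = lshift 1 (ord0 : 'I_1) by apply: val_inj.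
  by rewrite aE col_mxEu mxE.
- have -> : ord_max = rshift 1 (ord0 : 'I_1) by apply: val_inj.
  by rewrite aE col_mxEd mxE.
Qed.
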